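(* Let $X,Y\subset\mathbb{R}^n$ be closed convex sets with $S:=X\cap Y\neq\varnothing$. Let $T:\mathbb{R}^n\to\mathbb{R}^n$ be any admissible operator, let $(\alpha_k)_{k\ge 0}\subset(0,1)$ satisfy $\alpha_k\to 0$, let $z_0\in\mathbb{R}^n$, and let $(z_k)_{k\ge 0}$ be the ecCRM iterates $z_{k+1}=\mathrm{PCRM}\bigl(N^{\alpha_k}z_k\bigr)$, $k\ge 0$, which converge to a point $\bar z\in S$. Assume that (i) $\mathrm{int}(S)\neq\varnothing$; (ii) $\bar z\in\partial X\cap\partial Y$ and, in a neighborhood of $\bar z$, the boundaries $\partial X$ and $\partial Y$ are $C^1$ manifolds of dimension $n-1$. Then $(\mathrm{dist}(z_k,S))_{k\ge 0}$ converges to $0$ superlinearly, and $(z_k)$ converges to $\bar z$ superlinearly.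
   Context: $\mathbb{R}^n$ carries the Euclidean inner product and norm; $\mathrm{dist}(z,C)=\inf_{y\in C}\|z-y\|$. For a nonempty closed convex set $C$, $P_C$ is the metric projection onto $C$ and $R_C:=2P_C-\mathrm{Id}$ is the reflection. Circumcenter: for $z,v,w\in\mathbb{R}^n$, $\operatorname{circ}(z,v,w)$ is the point $c$ in the affine hull of $\{z,v,w\}$ with $\|c-z\|=\|c-v\|=\|c-w\|$; when it exists it is unique. Define $\mathrm{PCRM}(z):=\operatorname{circ}(z,R_X(z),R_Y(z))$. A point $z$ is centralized if $\langle z-P_Xz,\,z-P_Yz\rangle\le 0$. At centralized points the circumcenter defining $\mathrm{PCRM}(z)$ exists, and the points $N^{\alpha}z$ below are always centralized. Admissible operator: $T:\mathbb{R}^n\to\mathbb{R}^n$ is admissible if $T(\mathbb{R}^n)\subset Y$ and $\|Tz-s\|\le\|z-s\|$ for all $z\in\mathbb{R}^n$, $s\in S$. For $\alpha\in(0,1)$, $N^{\alpha}z:=\alpha\,Tz+(1-\alpha)\,P_X(Tz)$. The ecCRM iterates always converge to a point of $S$ (so $\bar z$ is well defined). A nonnegative sequence $(a_k)$ with $a_k\to 0$ converges superlinearly to $0$ if $a_{k+1}/a_k\to 0$, understood as: for every $\varepsilon>0$, $a_{k+1}\le\varepsilon a_k$ for all large $k$ (this includes the case where $a_k$ is eventually $0$). A sequence $(z_k)$ converges superlinearly to $\bar z$ if $\|z_k-\bar z\|$ converges superlinearly to $0$. *)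

(* Defs.v *)
From HB Require Import structures.
From mathcomp Require Export all_boot all_order all_algebra.
From mathcomp Require Export all_classical all_reals all_analysis.

Set Implicit Arguments.
Unset Strict Implicit.
Unset Printing Implicit Defensive.

Export Order.TTheory GRing.Theory Num.Theory.
Export numFieldNormedType.Exports.

Local Open Scope classical_set_scope.
Local Open Scope ring_scope.

(* The library norm on 'rV[R]_n is the sup norm, so the Euclidean structure of
   R^n is defined here. The library topology on 'rV[R]_n (hence open, closed,
   interior, closure, -->) is the usual one, and is used as is. *)

Definition dotv (R : realType) (n : nat) (x y : 'rV[R]_n) : R :=
  \sum_(i < n) x 0 i * y 0 i.

Definition enorm (R : realType) (n : nat) (x : 'rV[R]_n) : R :=
  Num.sqrt (dotv x x).

Definition edist (R : realType) (n : nat) (z : 'rV[R]_n) (C : set 'rV[R]_n)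
  : R := inf [set enorm (z - y) | y in C].

(* The default value 0 of xget is never used when C is nonempty, closed and
   convex: the nearest point then exists and is unique. *)
Definition proj (R : realType) (n : nat) (C : set 'rV[R]_n) (z : 'rV[R]_n)
  : 'rV[R]_n := xget 0 [set p | C p /\ enorm (z - p) = edist z C].

Definition refl (R : realType) (n : nat) (C : set 'rV[R]_n) (z : 'rV[R]_n)
  : 'rV[R]_n := 2%:R *: proj C z - z.

Definition affine_hull3 (R : realType) (n : nat) (z v w : 'rV[R]_n)
  : set 'rV[R]_n :=
  [set p | exists a b c : R,
     a + b + c = 1 /\ p = a *: z + b *: v + c *: w].

Definition is_circumcenter (R : realType) (n : nat) (z v w c : 'rV[R]_n)
  : Prop :=
  [/\ affine_hull3 z v w c,
      enorm (c - z) = enorm (c - v) & enorm (c - v) = enorm (c - w)].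

(* A circumcenter is unique when it exists; circ z v w is 0 if there is none
   (z, v, w distinct and collinear). *)
Definition circ (R : realType) (n : nat) (z v w : 'rV[R]_n) : 'rV[R]_n :=
  xget 0 (is_circumcenter z v w).

Definition PCRM (R : realType) (n : nat) (X Y : set 'rV[R]_n) (z : 'rV[R]_n)
  : 'rV[R]_n := circ z (refl X z) (refl Y z).

Definition admissible (R : realType) (n : nat) (X Y : set 'rV[R]_n)
    (T : 'rV[R]_n -> 'rV[R]_n) : Prop :=
  (forall z, Y (T z)) /\
  (forall z s, (X `&` Y) s -> enorm (T z - s) <= enorm (z - s)).

Definition Nop (R : realType) (n : nat) (X : set 'rV[R]_n)
    (T : 'rV[R]_n -> 'rV[R]_n) (alpha : R) (z : 'rV[R]_n) : 'rV[R]_n :=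
  alpha *: T z + (1 - alpha) *: proj X (T z).

Fixpoint ecCRM (R : realType) (n : nat) (X Y : set 'rV[R]_n)
    (T : 'rV[R]_n -> 'rV[R]_n) (alpha : nat -> R) (z0 : 'rV[R]_n) (k : nat)
  : 'rV[R]_n :=
  if k is k'.+1
  then PCRM X Y (Nop X T (alpha k') (ecCRM X Y T alpha z0 k'))
  else z0.

Definition boundary (T : topologicalType) (A : set T) : set T :=
  closure A `\` interior A.

(* Meant for U open, so that continuity of the Jacobian at the points of U is
   continuity on U. *)
Definition C1_on (R : realType) (n m : nat) (U : set 'rV[R]_n)
    (f : 'rV[R]_n -> 'rV[R]_m) : Prop :=
  forall x, U x -> differentiable f x /\ {for x, continuous (jacobian f)}.

Definition C1_diffeo (R : realType) (n : nat) (U V : set 'rV[R]_n)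
    (phi : 'rV[R]_n -> 'rV[R]_n) : Prop :=
  exists psi : 'rV[R]_n -> 'rV[R]_n,
    [/\ forall x, U x -> V (phi x) /\ psi (phi x) = x,
        forall y, V y -> U (psi y) /\ phi (psi y) = y,
        C1_on U phi & C1_on V psi].

(* Embedded d-dimensional C^1 submanifold of R^n: around each of its points, a
   C^1 diffeomorphism of the ambient space straightens M into
   R^d x {0}, the set of y whose coordinates of index >= d vanish. *)
Definition C1_submanifold (R : realType) (n d : nat) (M : set 'rV[R]_n)
  : Prop :=
  forall p, M p ->
    exists (U V : set 'rV[R]_n) (phi : 'rV[R]_n -> 'rV[R]_n),
      [/\ open_nbhs p U, open V, C1_diffeo U V phi &
          phi @` (U `&` M) =
          V `&` [set y | forall j : 'I_n, (d <= j)%N -> y 0 j = 0]].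

Definition superlinear_to0 (R : realType) (a : nat -> R) : Prop :=
  [/\ forall k, 0 <= a k,
      a k @[k --> \oo] --> (0 : R) &
      forall e : R, 0 < e -> \forall k \near \oo, a k.+1 <= e * a k].

Definition superlinear_to (R : realType) (n : nat) (z : nat -> 'rV[R]_n)
    (l : 'rV[R]_n) : Prop :=
  superlinear_to0 (fun k => enorm (z k - l)).

(* Main.v *)
Require Import Defs.
From mathcomp Require Import ring lra.

(* The circumcenter [c] of the centralized point [u] is the projection of [u]
   onto the intersection of the hyperplanes supporting [X] at [P_X u] and [Y] at
   [P_Y u], hence the iterates are Fejer monotone with respect to [S].  As the
   boundaries are smooth at [zbar], there is only one unit outer normal there,
   and by compactness all unit outer normals at nearby points are close to it.
   So near [zbar] a supporting hyperplane stays close to the set: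
   [dist(c,X) = o(|c - P_X u|)], and likewise for [Y] when [u] is not in [Y];
   when it is, [c = P_X u] and [dist(c,Y) <= alpha |Tz - P_X (Tz)|] with
   [alpha -> 0].  Both are [o(dist(z,S))], and the interior point of [S] turns
   this into [dist(c,S) = o(dist(z,S))].  Fejer monotonicity also gives
   [|z_k - zbar| <= 2 dist(z_k,S)]. *)

Local Open Scope classical_set_scope.
Local Open Scope ring_scope.

(** * Euclidean inner product and norm, and their link with the library topology *)

Section Euclid.
Set Implicit Arguments.
Unset Strict Implicit.
Context {R : realType} {n : nat}.
Implicit Types (x y z a b c s u : 'rV[R]_n) (t : R).

Lemma dotvC x y : dotv x y = dotv y x.
Proof. by apply: eq_bigr => i _; rewrite mulrC. Qed.

Lemma dotvDl x y z : dotv (x + y) z = dotv x z + dotv y z.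
Proof. by rewrite /dotv -big_split; apply: eq_bigr => i _; rewrite mxE mulrDl. Qed.

Lemma dotvZl t x y : dotv (t *: x) y = t * dotv x y.
Proof. by rewrite /dotv mulr_sumr; apply: eq_bigr => i _; rewrite mxE mulrA. Qed.

Lemma dotvNl x y : dotv (- x) y = - dotv x y.
Proof. by rewrite -scaleN1r dotvZl mulN1r. Qed.

Lemma dotvDr x y z : dotv z (x + y) = dotv z x + dotv z y.
Proof. by rewrite dotvC dotvDl !(dotvC z). Qed.

Lemma dotvZr t x y : dotv y (t *: x) = t * dotv y x.
Proof. by rewrite dotvC dotvZl dotvC. Qed.

Lemma dotvNr x y : dotv y (- x) = - dotv y x.
Proof. by rewrite dotvC dotvNl dotvC. Qed.

Definition dotvE := (dotvDl, dotvDr, dotvNl, dotvNr, dotvZl, dotvZr).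

Lemma dot0v x : dotv 0 x = 0.
Proof. by rewrite -(scale0r x) dotvZl mul0r. Qed.

Lemma dotv_ge0 x : 0 <= dotv x x.
Proof. by apply: sumr_ge0 => i _; rewrite -expr2 sqr_ge0. Qed.

Lemma dotv_eq0 x : (dotv x x == 0) = (x == 0).
Proof.
apply/idP/eqP => [|->]; last by rewrite dot0v.
rewrite psumr_eq0 => [/allP x0|i _]; last by rewrite -expr2 sqr_ge0.
apply/rowP => i; rewrite mxE; apply/eqP.
by have := x0 i (mem_index_enum i); rewrite /= -expr2 sqrf_eq0.
Qed.

Lemma enorm_sqr x : enorm x ^+ 2 = dotv x x.
Proof. by rewrite sqr_sqrtr// dotv_ge0. Qed.

Lemma enorm_ge0 x : 0 <= enorm x.
Proof. exact: sqrtr_ge0. Qed.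

Lemma enorm_eq0 x : (enorm x == 0) = (x == 0).
Proof. by rewrite -sqrf_eq0 enorm_sqr dotv_eq0. Qed.

Lemma enorm0 : enorm (0 : 'rV[R]_n) = 0.
Proof. by apply/eqP; rewrite enorm_eq0. Qed.

Lemma ler_enorm x y : (enorm x <= enorm y) = (dotv x x <= dotv y y).
Proof. by rewrite ler_sqrt// dotv_ge0. Qed.

Lemma eqr_enorm x y : enorm x = enorm y <-> dotv x x = dotv y y.
Proof. by split=> [xy|xy]; [rewrite -!enorm_sqr xy|rewrite /enorm xy]. Qed.

Lemma enormZ t x : enorm (t *: x) = `|t| * enorm x.
Proof.
by rewrite /enorm dotvZl dotvZr mulrA -expr2 sqrtrM ?sqr_ge0// sqrtr_sqr.
Qed.

Lemma enormN x : enorm (- x) = enorm x.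
Proof. by apply/eqr_enorm; rewrite !dotvE opprK. Qed.

Lemma enormB x y : enorm (x - y) = enorm (y - x).
Proof. by rewrite -enormN opprB. Qed.

(** Cauchy-Schwarz: expand the square of [dotv y y *: x - dotv x y *: y] and divide by
    [dotv y y]. *)
Lemma dotv_sqr_le x y : dotv x y ^+ 2 <= dotv x x * dotv y y.
Proof.
have [->|y0] := eqVneq y 0; first by rewrite dotvC !dot0v expr0n/= mulr0.
have yy : 0 < dotv y y by rewrite lt_def dotv_eq0 y0 dotv_ge0.
have := dotv_ge0 (dotv y y *: x - dotv x y *: y).
rewrite !dotvE (dotvC y x) => h.
rewrite -(ler_pM2l yy) -subr_ge0; apply: le_trans h _.
by rewrite le_eqVlt; apply/orP; left; apply/eqP; ring.
Qed.

Lemma dotv_le_enorm x y : dotv x y <= enorm x * enorm y.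
Proof.
apply: le_trans (ler_norm _) _; rewrite -sqrtr_sqr -sqrtrM ?dotv_ge0//.
by rewrite ler_sqrt ?dotv_sqr_le// mulr_ge0// dotv_ge0.
Qed.

Lemma ler_enormD x y : enorm (x + y) <= enorm x + enorm y.
Proof.
rewrite -(@ler_pXn2r _ 2) ?nnegrE ?addr_ge0 ?enorm_ge0//.
rewrite sqrrD !enorm_sqr !dotvE (dotvC y x).
by have := dotv_le_enorm x y; lra.
Qed.

Lemma ler_enorm_dist z x y : enorm (x - y) <= enorm (x - z) + enorm (z - y).
Proof. by have := ler_enormD (x - z) (z - y); rewrite addrA subrK. Qed.

(** Bridge from the sup norm of the library: Euclidean balls become neighbourhoods, and Euclidean
    bounds give compactness. *)
Lemma norm_le_enorm x : `|x| <= enorm x.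
Proof.
rewrite [leLHS]mx_normrE; apply/bigmax_leP; split=> [|[i j] _] /=.
  exact: enorm_ge0.
rewrite ord1 -sqrtr_sqr ler_sqrt ?dotv_ge0// /dotv (bigD1 j)//= -expr2.
by rewrite lerDl sumr_ge0// => k _; rewrite -expr2 sqr_ge0.
Qed.

Lemma cvg_dotv {U : Type} {F : set_system U} {FF : Filter F}
    (f g : U -> 'rV[R]_n) x y :
  f t @[t --> F] --> x -> g t @[t --> F] --> y ->
  dotv (f t) (g t) @[t --> F] --> dotv x y.
Proof.
move=> fx gy.
have cvg_coord (h : U -> 'rV[R]_n) z i :
    h t @[t --> F] --> z -> h t 0 i @[t --> F] --> z 0 i.
  move=> hz; apply: (continuous_cvg FF (h := fun M : 'rV[R]_n => M 0 i)) hz.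
  exact: coord_continuous.
by apply: cvg_big => [|i _]; [exact: add_continuous|apply: cvgM; exact: cvg_coord].
Qed.

Lemma cvg_enorm {U : Type} {F : set_system U} {FF : Filter F}
    (f : U -> 'rV[R]_n) x :
  f t @[t --> F] --> x -> enorm (f t) @[t --> F] --> enorm x.
Proof.
move=> fx; apply: (continuous_cvg FF (@sqrt_continuous R _)).
exact: cvg_dotv.
Qed.

Lemma enorm_nbhs x (e : R) : 0 < e -> \forall y \near x, enorm (y - x) < e.
Proof.
move=> e0; have h : y - x @[y --> x] --> x - x.
  by apply: (cvgB (F := nbhs x)); [exact|exact: cvg_cst].
have := cvg_enorm (FF := nbhs_filter x) h.
by rewrite subrr enorm0 => /cvgr_lt; exact.
Qed.

Lemma nbhs_enormP x (A : set 'rV[R]_n) : nbhs x A ->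
  exists2 e : R, 0 < e & forall y, enorm (y - x) < e -> A y.
Proof.
move=> /nbhs_ballP[e /= e0 eA]; exists e => // y yx; apply: eA.
rewrite -ball_normE /=; apply: le_lt_trans (norm_le_enorm _) _.
by rewrite enormB.
Qed.

Lemma convex_setP (C : set 'rV[R]_n) x y t : convex_set C -> C x -> C y ->
  0 <= t <= 1 -> C (t *: x + (1 - t) *: y).
Proof.
move=> cvC Cx Cy /andP[t0 t1].
have ti : Itv.spec (@Itv.num_sem R) (Itv.Real `[0%Z, 1%Z]) t.
  by rewrite /= /Itv.num_sem /= in_itv /= ger0_real//= t0 t1.
by have := cvC x y (Itv.mk ti); rewrite !inE => /(_ Cx Cy).
Qed.

Lemma enorm_sub_continuous z : continuous (fun y => enorm (z - y)).
Proof.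
move=> y; have h : z - t @[t --> y] --> z - y.
  by apply: (cvgB (F := nbhs y)); [exact: cvg_cst|exact].
exact: (cvg_enorm (FF := nbhs_filter y) h).
Qed.

Lemma closed_enorm_sub z (A : set R) :
  closed A -> closed [set y | A (enorm (z - y))].
Proof. by move=> clA; exact: (continuous_closedP _).1 (@enorm_sub_continuous z) _ clA. Qed.

Lemma compact_enorm_ball z r (C : set 'rV[R]_n) : closed C ->
  compact (C `&` [set y | enorm (z - y) <= r]).
Proof.
move=> clC; apply: bounded_closed_compact; last first.
  by apply: closedI => //; exact: (closed_enorm_sub (closed_le (y := r))).
exists (enorm z + r); split; first exact: num_real.
move=> M hM y [_ /= zy]; apply: le_trans (norm_le_enorm _) _.
apply: le_trans (ltW hM).
have := ler_enorm_dist z y 0; rewrite !subr0 (enormB y); lra.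
Qed.

End Euclid.

(** * Metric projection onto a closed convex set *)

Section Projection.
Set Implicit Arguments.
Unset Strict Implicit.
Context {R : realType} {n : nat}.
Implicit Types (C : set 'rV[R]_n) (x y z p s u : 'rV[R]_n).

Lemma edist_le C z y : C y -> edist z C <= enorm (z - y).
Proof.
move=> Cy; apply: ge_inf; last by exists y.
by exists 0 => _ [x _ <-]; exact: enorm_ge0.
Qed.

Lemma edist_ge0 C z : C !=set0 -> 0 <= edist z C.
Proof.
move=> [y Cy]; apply: lb_le_inf; first by exists (enorm (z - y)), y.
by move=> _ [x _ <-]; exact: enorm_ge0.
Qed.

(** By compactness there is a minimiser over the part of [C] within [enorm (z - y0)] of [z]; it is
    global, since other points are farther than [y0]. *)
Lemma proj_spec C z : closed C -> C !=set0 ->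
  C (proj C z) /\ enorm (z - proj C z) = edist z C.
Proof.
move=> clC [y0 Cy0]; rewrite /proj.
apply: (@xgetPex _ 0 [set p | C p /\ enorm (z - p) = edist z C]).
have KC := compact_enorm_ball (z := z) (r := enorm (z - y0)) clC.
have K0 : C `&` [set y | enorm (z - y) <= enorm (z - y0)] !=set0.
  by exists y0; split => /=.
have [p] := EVT_min_rV K0 KC (continuous_subspaceT (@enorm_sub_continuous R n z)).
rewrite inE => -[Cp zp] pmin; exists p; split=> //.
apply/eqP; rewrite eq_le edist_le// andbT.
apply: lb_le_inf; first by exists (enorm (z - y0)), y0.
move=> _ [y Cy <-]; have [zy|/ltW zy] := leP (enorm (z - y)) (enorm (z - y0)).
  by apply: pmin; rewrite inE.
exact: le_trans zp zy.
Qed.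

Lemma proj_in C z : closed C -> C !=set0 -> C (proj C z).
Proof. by move=> clC C0; have [] := proj_spec z clC C0. Qed.

Lemma proj_obtuse C z y : closed C -> convex_set C -> C y ->
  dotv (z - proj C z) (y - proj C z) <= 0.
Proof.
move=> clC cvC Cy.
have [Cp zp] := proj_spec z clC (ex_intro _ y Cy).
set p := proj C z in Cp zp *; set D := dotv _ _.
set q := dotv (y - p) (y - p).
rewrite leNgt; apply/negP => D0.
have q0 : 0 <= q by exact: dotv_ge0.
(* If [D] were positive, moving from [p] towards [y] by [t = D / (D + q)] would change the squared
   distance to [z] by [- t * D * (1 + t) < 0]. *)
have t01 : 0 <= D / (D + q) <= 1.
  by rewrite divr_ge0 ?ler_pdivrMr ?mul1r ?lerDl//; lra.
have := edist_le z (convex_setP cvC Cy Cp t01).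
rewrite -zp ler_enorm; set t := D / (D + q).
have -> : z - (t *: y + (1 - t) *: p) = (z - p) - t *: (y - p).
  by apply/rowP => i; rewrite !mxE; ring.
move: (z - p) (y - p) @D @q D0 q0 t01 @t => v w D q D0 q0 t01 t.
rewrite !dotvE (dotvC w v) -/D -/q => h.
have tq : t * (D + q) = D by rewrite /t divfK//; lra.
have t0 : 0 < t by rewrite /t divr_gt0//; lra.
by nra.
Qed.

Lemma proj_unique C z p : closed C -> convex_set C -> C p ->
  (forall y, C y -> dotv (z - p) (y - p) <= 0) -> proj C z = p.
Proof.
move=> clC cvC Cp ob.
have h1 := proj_obtuse z clC cvC Cp.
have h2 := ob _ (proj_in z clC (ex_intro _ p Cp)).
apply/eqP; rewrite -subr_eq0 -dotv_eq0 eq_le dotv_ge0 andbT.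
move: h1 h2; rewrite !dotvE (dotvC p (proj C z)); lra.
Qed.

Lemma proj_id C z : closed C -> convex_set C -> C z -> proj C z = z.
Proof. by move=> clC cvC Cz; apply: proj_unique => // y _; rewrite subrr dot0v. Qed.

(** Expand [u - s = (u - c) - (s - c)]: the cross term is nonnegative. This gives the Fejer property
    both of projections and of the circumcenter step. *)
Lemma enorm_sub_le u c s : dotv (u - c) (s - c) <= 0 ->
  enorm (c - s) <= enorm (u - s).
Proof.
rewrite ler_enorm => h.
have -> : u - s = (u - c) - (s - c) by rewrite opprB addrA subrK.
rewrite -(opprB s c) !dotvE in h *.
have := dotv_ge0 (u - c); rewrite !dotvE.
rewrite (dotvC c u) (dotvC s u) (dotvC s c) in h *; lra.
Qed.

Lemma proj_fejer C z s : closed C -> convex_set C -> C s ->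
  enorm (proj C z - s) <= enorm (z - s).
Proof. by move=> clC cvC Cs; apply: enorm_sub_le; exact: proj_obtuse. Qed.

End Projection.

(** * Circumcenter of a point and two reflections of it *)

Section Circumcenter.
Set Implicit Arguments.
Unset Strict Implicit.
Context {R : realType} {n : nat}.
Implicit Types (C X Y : set 'rV[R]_n) (a b c s u : 'rV[R]_n).

Lemma reflE C u : refl C u = u - 2 *: (u - proj C u).
Proof. by rewrite /refl; apply/rowP => i; rewrite !mxE; ring. Qed.

(** Equidistance from [u] and [u - 2 *: a] is linear in [c]: for nonzero [a] it is the hyperplane
    through [u - a] orthogonal to [a], which supports [C] at [proj C u] when [a = u - proj C u]. *)
Lemma circumcenter_reflP u a b c :
  is_circumcenter u (u - 2 *: a) (u - 2 *: b) c <->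
  [/\ exists l m : R, c = u + l *: a + m *: b,
      dotv (c - u) a = - dotv a a & dotv (c - u) b = - dotv b b].
Proof.
have E v : enorm (c - u) = enorm (c - (u - 2 *: v)) <->
    dotv (c - u) v = - dotv v v.
  rewrite eqr_enorm opprB addrA addrAC; move: (c - u) => w.
  rewrite !dotvE (dotvC v w); split; lra.
split=> [[[p [q [r [pqr cE]]]] e1 e2]|[[l [m cE]] e1 e2]].
  split; [|exact/E|by apply/E; rewrite e1].
  exists (- 2 * q), (- 2 * r).
  by rewrite cE; have -> : p = 1 - q - r by [rewrite -pqr; ring]; apply/rowP => i; rewrite !mxE; ring.
split; [|exact/E|by rewrite -(E a).2// -(E b).2].
exists (1 + l / 2 + m / 2), (- (l / 2)), (- (m / 2)); split; first by field.
by rewrite cE; apply/rowP => i; rewrite !mxE; field.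
Qed.

(* The hypothesis on [s] rules out the antiparallel case, in which the three
   points are distinct and collinear. *)
Lemma circ_reflP u a b s : dotv a b <= 0 ->
    dotv (s - u) a <= - dotv a a -> dotv (s - u) b <= - dotv b b ->
  let c := circ u (u - 2 *: a) (u - 2 *: b) in
  [/\ exists l m : R, [/\ l <= 0, m <= 0 & c = u + l *: a + m *: b],
      dotv (c - u) a = - dotv a a & dotv (c - u) b = - dotv b b].
Proof.
move=> ab sa sb c.
set A := dotv a a in sa *; set B := dotv b b in sb *; set D := dotv a b in ab *.
have [A0 B0] : 0 <= A /\ 0 <= B by rewrite !dotv_ge0.
have bw l m v : dotv (u + l *: a + m *: b - u) v = l * dotv a v + m * dotv b v.
  by rewrite -(addrA u) (addrC u) addrK !dotvE.
have cP : (exists c', is_circumcenter u (u - 2 *: a) (u - 2 *: b) c') ->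
    is_circumcenter u (u - 2 *: a) (u - 2 *: b) c by exact: xgetPex.
have [a0|a0] := eqVneq a 0.
  have A0' : A = 0 by rewrite /A a0 dot0v.
  have D0' : D = 0 by rewrite /D a0 dot0v.
  have /cP/circumcenter_reflP[[l [m cE]] e1 e2] :
      exists c', is_circumcenter u (u - 2 *: a) (u - 2 *: b) c'.
    exists (u + 0 *: a + (-1) *: b); apply/circumcenter_reflP; split.
    - by exists 0, (-1).
    - by rewrite bw (dotvC b a) -/A -/D A0' D0'; lra.
    - by rewrite bw -/B -/D D0'; lra.
  split=> //; have [b0|b0] := eqVneq b 0.
    by exists 0, 0; split => //; rewrite cE a0 b0 !scaler0.
  (* With [a = 0] the coefficient [l] is arbitrary, so 0 replaces it; the sign of [m] comes from
     [m * B = - B]. *)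
  exists 0, m; split => //; last by rewrite cE a0 !scaler0.
  move: e2; rewrite cE bw -/D -/B D0' => e2.
  have B0' : 0 < B by rewrite lt_def dotv_eq0 b0.
  by nra.
have A0' : 0 < A by rewrite lt_def dotv_eq0 a0.
have [b0|b0] := eqVneq b 0.
  have B0' : B = 0 by rewrite /B b0 dot0v.
  have D0' : D = 0 by rewrite /D b0 dotvC dot0v.
  have /cP/circumcenter_reflP[[l [m cE]] e1 e2] :
      exists c', is_circumcenter u (u - 2 *: a) (u - 2 *: b) c'.
    exists (u + (-1) *: a + 0 *: b); apply/circumcenter_reflP; split.
    - by exists (-1), 0.
    - by rewrite bw (dotvC b a) -/A -/D D0'; lra.
    - by rewrite bw -/B -/D B0' D0'; lra.
  split=> //; exists l, 0; split => //; last by rewrite cE b0 !scaler0.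
  move: e1; rewrite cE bw (dotvC b a) -/D -/A D0' => e1.
  by nra.
have B0' : 0 < B by rewrite lt_def dotv_eq0 b0.
(* A zero Gram determinant gives [B *: a = D *: b] with [D < 0]; the inequalities on [s] then make
   its pairing with the left side negative and with the right side positive. *)
have gram : 0 < A * B - D ^+ 2.
  rewrite lt_def subr_eq0 subr_ge0 dotv_sqr_le andbT; apply/eqP => AB.
  have v0 : B *: a - D *: b = 0.
    apply/eqP; rewrite -dotv_eq0; apply/eqP.
    by rewrite !dotvE (dotvC b a) -/A -/B -/D; nra.
  have : dotv (s - u) (B *: a - D *: b) = 0 by rewrite v0 dotvC dot0v.
  rewrite dotvDr dotvNr !dotvZr => h.
  have D0 : D != 0.
    by apply/eqP => D0; move: (mulr_gt0 A0' B0'); rewrite AB D0 expr0n ltxx.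
  have D0' : D < 0 by rewrite lt_neqAle D0.
  have : B * dotv (s - u) a <= - (B * A) by rewrite -mulrN ler_pM2l.
  have : - D * dotv (s - u) b <= - D * - B by rewrite ler_pM2l// oppr_gt0.
  by have := mulr_gt0 A0' B0'; have := mulr_gt0 B0' (_ : 0 < - D); nra.
have /cP/circumcenter_reflP[[l [m cE]] e1 e2] :
    exists c', is_circumcenter u (u - 2 *: a) (u - 2 *: b) c'.
  (* Cramer's rule for [l * A + m * D = - A] and [l * D + m * B = - B]. *)
  exists (u + ((B * D - A * B) / (A * B - D ^+ 2)) *: a
            + ((A * D - A * B) / (A * B - D ^+ 2)) *: b).
  apply/circumcenter_reflP; split; first by do 2 eexists.
    by rewrite bw (dotvC b a) -/A -/D; field; rewrite gt_eqF.
  by rewrite bw -/B -/D; field; rewrite gt_eqF.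
split=> //; exists l, m; split => //.
  (* The numerators [B * (D - A)] and [A * (D - B)] are nonpositive because [D <= 0], which is the
     centralization hypothesis. *)
  rewrite -(pmulr_rle0 _ gram).
  have -> : (A * B - D ^+ 2) * l = B * (D - A).
    move: e1 e2; rewrite cE !bw (dotvC b a) -/A -/B -/D => e1 e2.
    have -> : (A * B - D ^+ 2) * l = B * (l * A + m * D) - D * (l * D + m * B) by ring.
    by rewrite e1 e2; ring.
  by nra.
rewrite -(pmulr_rle0 _ gram).
have -> : (A * B - D ^+ 2) * m = A * (D - B).
  move: e1 e2; rewrite cE !bw (dotvC b a) -/A -/B -/D => e1 e2.
  have -> : (A * B - D ^+ 2) * m = A * (l * D + m * B) - D * (l * A + m * D) by ring.
  by rewrite e1 e2; ring.
by nra.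
Qed.

End Circumcenter.

(** * Outer normals and their uniqueness at smooth boundary points *)

Definition outer_normal {R : realType} {n : nat} (C : set 'rV[R]_n)
  (p v : 'rV[R]_n) : Prop := forall y, C y -> dotv (y - p) v <= 0.

Section Normals.
Set Implicit Arguments.
Unset Strict Implicit.
Context {R : realType}.

(** Pushing [s] by [e / 2] along [v] stays in [C], so the pairing is at most [- e / 2]. *)
Lemma interior_normal_lt0 n (C : set 'rV[R]_n) (p v s : 'rV[R]_n) :
  interior C s -> outer_normal C p v -> enorm v = 1 -> dotv (s - p) v < 0.
Proof.
move=> /nbhs_enormP[e e0 eC] Nv v1.
have /Nv : C (s + (e / 2) *: v).
  by apply: eC; rewrite addrC addKr enormZ v1 mulr1 gtr0_norm; lra.
rewrite !dotvE -enorm_sqr v1; lra.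
Qed.

(** Right difference quotients of [f] along [e] pair nonpositively with [v]; pass to the limit. *)
Lemma diff_normal_le0 n (C : set 'rV[R]_n) (f : 'rV[R]_n -> 'rV[R]_n)
    (y e v : 'rV[R]_n) :
  differentiable f y -> outer_normal C (f y) v ->
  (\forall t \near (0 : R), C (f (y + t *: e))) ->
  dotv ('d f y e) v <= 0.
Proof.
move=> df Nv fC; rewrite -deriveE//.
have cv : h^-1 *: ((f \o shift y) (h *: e) - f y) @[h --> 0^'+] --> 'D_e f y.
  by apply: cvg_dnbhs_at_right; exact: diff_derivable.
have dcv : dotv (h^-1 *: ((f \o shift y) (h *: e) - f y)) v @[h --> 0^'+] -->
    dotv ('D_e f y) v by apply: cvg_dotv cv _; exact: cvg_cst.
rewrite -(cvg_lim (@Rhausdorff R) dcv).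
apply: limr_le; first by apply/cvg_ex; exists (dotv ('D_e f y) v).
near=> h; have h0 : 0 < h by near: h; exact: nbhs_right_gt.
rewrite dotvZl pmulr_rle0 ?invr_gt0//; apply: Nv.
rewrite /= addrC; near: h.
exact: cvg_within fC.
Unshelve. all: by end_near. Qed.

(* For [e] in the hyperplane, the curve [t |-> psi (y0 + t e)] runs inside the
   boundary, so every normal is orthogonal to ['d psi y0 e].  This leaves a line,
   of which the interior point selects one direction. *)
Lemma C1_boundary_normal_unique n (C W : set 'rV[R]_n) (p v w s : 'rV[R]_n) :
  closed C -> interior C s -> open_nbhs p W -> boundary C p ->
  C1_submanifold n.-1 (boundary C `&` W) ->
  outer_normal C p v -> outer_normal C p w -> enorm v = 1 -> enorm w = 1 ->
  v = w.
Proof.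
(* In dimension 0 all vectors agree; otherwise the straightened boundary is the hyperplane where
   only the coordinate [ord_max] must vanish. *)
case: n => [|n] in C W p v w s *; first by move=> *; apply/rowP => -[].
move=> clC Cs [oW Wp] bdp /(_ p (conj bdp Wp)) /=.
move=> [U [V [phi [[oU Up] oV [psi [UV VU dphi dpsi]] img]]]] Nv Nw v1 w1.
set y0 := phi p; have [Vy0 psiy0] := UV _ Up; rewrite -/y0 in Vy0 psiy0.
have [dpsi0 _] := dpsi _ Vy0; have [dphi0 _] := dphi _ Up.
have y0M : y0 0 ord_max = 0.
  have : (phi @` (U `&` (boundary C `&` W))) y0 by exists p.
  by rewrite img => -[_]; apply.
have tangent u (e : 'rV[R]_n.+1) : outer_normal C p u -> e 0 ord_max = 0 ->
    dotv ('d psi y0 e) u <= 0.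
  move=> Nu e0; apply: (@diff_normal_le0 _ C) => //; first by rewrite psiy0.
  have Vt : \forall t \near (0 : R), V (y0 + t *: e).
    have h : y0 + t *: e @[t --> (0 : R)] --> y0 + 0 *: e.
      by apply: cvgD; [exact: cvg_cst|apply: cvgZr_tmp; exact].
    apply: h; rewrite scale0r addr0; exact: open_nbhs_nbhs.
  near=> t.
  have Vyt : V (y0 + t *: e) by near: t.
  have : (phi @` (U `&` (boundary C `&` W))) (y0 + t *: e).
    rewrite img; split=> //= j nj.
    have -> : j = ord_max.
      by apply/val_inj => /=; apply/eqP; rewrite eqn_leq nj -ltnS ltn_ord.
    by rewrite !mxE y0M e0 mulr0 addr0.
  move=> [x [Ux [[clx _] _]] <-]; have [_ ->] := UV _ Ux.
  by move: clx; rewrite -((closure_id C).1 clC).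
have tangent0 u (e : 'rV[R]_n.+1) : outer_normal C p u -> e 0 ord_max = 0 ->
    dotv ('d psi y0 e) u = 0.
  move=> Nu e0; apply/eqP; rewrite eq_le tangent//= -oppr_le0 -dotvNl -linearN.
  by apply: tangent => //; rewrite mxE e0 oppr0.
(* As [psi \o phi] is the identity near [p], the chain rule makes ['d phi p] a right inverse of
   ['d psi y0]. *)
have chain h : 'd psi y0 ('d phi p h) = h.
  have -> : 'd psi y0 ('d phi p h) = 'd (psi \o phi) p h.
    by have /(congr1 (fun F : 'rV[R]_n.+1 -> 'rV[R]_n.+1 => F h)) := diff_comp dphi0 dpsi0.
  rewrite -deriveE; last exact: differentiable_comp.
  rewrite -[RHS](derive_id p h); apply: near_eq_derive.
  near=> x; have Ux : U x by near: x; apply: open_nbhs_nbhs.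
  by have [] := UV _ Ux.
have {tangent tangent0 chain} [J [K [tangent chain]]] :
    exists (J : {linear 'rV[R]_n.+1 -> 'rV[R]_n.+1}) (K : 'rV[R]_n.+1 -> 'rV[R]_n.+1),
      (forall u (e : 'rV[R]_n.+1), outer_normal C p u -> e 0 ord_max = 0 -> dotv (J e) u = 0) /\
      (forall h, J (K h) = h) by exists ('d psi y0), ('d phi p); split.
(* Write [h = J (K h)] and drop the part of [K h] in the hyperplane: pairing with a normal [u]
   factors as [tau h * m u], so the normals at [p] are collinear. *)
pose m u := dotv (J (delta_mx 0 ord_max)) u.
pose tau h := K h 0 ord_max.
have dotm h u : outer_normal C p u -> dotv h u = tau h * m u.
  move=> Nu; rewrite -{1}(chain h) /tau; move: (K h) => k.
  pose e := k - k 0 ord_max *: delta_mx 0 ord_max.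
  have e0 : e 0 ord_max = 0 by rewrite !mxE !eqxx/= mulr1 subrr.
  have {1}-> : k = e + k 0 ord_max *: delta_mx 0 ord_max by rewrite subrK.
  by rewrite linearD linearZ/= dotvDl dotvZl tangent// add0r.
(* The interior point forces [m v] and [m w] to have the same sign, which excludes [w = - v]. *)
have [sv sw] : tau (s - p) * m v < 0 /\ tau (s - p) * m w < 0.
  by rewrite -!dotm//; split; apply: interior_normal_lt0 Cs _ _.
have prop : m w *: v = m v *: w.
  apply/eqP; rewrite -subr_eq0 -dotv_eq0; apply/eqP.
  by rewrite dotvDr dotvNr !dotvZr !dotm//; ring.
have : enorm (m w *: v) = enorm (m v *: w) by rewrite prop.
rewrite !enormZ v1 w1 !mulr1 => /eqP; rewrite eqr_norm2 => /orP[/eqP mm|/eqP mm].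
  move: prop; rewrite mm; apply: scalerI.
  by apply/eqP => m0; move: sv; rewrite m0 mulr0 ltxx.
by move: sw; rewrite mm mulrN oppr_lt0 => /(lt_trans sv); rewrite ltxx.
Unshelve. all: by end_near. Qed.

End Normals.

(** * Flatness near a smooth point, and distance to an intersection *)

Section Tangency.
Set Implicit Arguments.
Unset Strict Implicit.
Context {R : realType} {n : nat}.
Implicit Types (C : set 'rV[R]_n) (p q v c z s : 'rV[R]_n).

Lemma proj_normal C z : closed C -> convex_set C ->
  outer_normal C (proj C z) (z - proj C z).
Proof. by move=> clC cvC y Cy; rewrite dotvC; exact: proj_obtuse. Qed.

Lemma outer_normalZ C p v (t : R) : 0 <= t ->
  outer_normal C p v -> outer_normal C p (t *: v).
Proof. by move=> t0 Nv y /Nv; rewrite dotvZr => /(mulr_ge0_le0 t0). Qed.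

Lemma enorm_normalized v : v != 0 -> enorm ((enorm v)^-1 *: v) = 1.
Proof.
move=> v0; rewrite enormZ ger0_norm ?invr_ge0 ?enorm_ge0//.
by rewrite mulVf// enorm_eq0.
Qed.

(** A unit [v] at distance at least [e] from [v0] is not normal at [p0], so some [y] in [C] has
    [0 < dotv (y - p0) v]. This persists for nearby [p] and [v], and compactness of the set of such
    [v] makes the neighbourhood of [p0] uniform. *)
Lemma unit_normals_cvg C p0 v0 (e : R) : 0 < e ->
  (forall v, outer_normal C p0 v -> enorm v = 1 -> v = v0) ->
  \forall p \near p0, forall v, outer_normal C p v -> enorm v = 1 ->
    enorm (v - v0) < e.
Proof.
move=> e0 uniq.
pose A := [set v | 1 <= enorm (0 - v)] `&` [set v | e <= enorm (v0 - v)].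
have clA : closed A.
  apply: closedI.
    exact: (closed_enorm_sub (closed_ge (y := 1))).
  exact: (closed_enorm_sub (closed_ge (y := e))).
have /compact_near_coveringP cov := compact_enorm_ball (z := 0) (r := 1) clA.
pose P (p v : 'rV[R]_n) := exists2 y, C y & 0 < dotv (y - p) v.
have : \forall p \near p0,
    A `&` [set v | enorm (0 - v) <= 1] `<=` P p.
  apply: (cov _ (nbhs p0) P (nbhs_filter p0)) => v [[v1 ve] v1'].
  have vn : enorm v = 1.
    by apply/eqP; rewrite eq_le -enormN -sub0r v1 v1'.
  have [y Cy yv] : exists2 y, C y & 0 < dotv (y - p0) v.
    apply: contrapT => noy; move: ve.
    rewrite /= (uniq v) ?subrr ?enorm0 ?leNgt ?e0// => y Cy.
    by rewrite leNgt; apply/negP => h; apply: noy; exists y.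
  have d : dotv (y - h.2) h.1 @[h --> filter_prod (nbhs v) (nbhs p0)] -->
      dotv (y - p0) v.
    apply: cvg_dotv; last exact: cvg_fst.
    apply: (cvgB (F := filter_prod (nbhs v) (nbhs p0))); first exact: cvg_cst.
    exact: cvg_snd.
  apply: (filterS (F := filter_prod (nbhs v) (nbhs p0)) _ (cvgr_gt _ d _ yv)).
  by move=> [v' p'] /= h; exists y.
apply: filterS => p AP v Nv v1; rewrite ltNge; apply/negP => ve.
have [|y Cy] := AP v; last by rewrite ltNge Nv.
by rewrite /A /= sub0r enormN v1 (enormB v0).
Qed.

(* Two unit normals near [p0] are almost equal, so a point [c] on a supporting
   hyperplane at [p] is almost on the one at its own projection. *)
Lemma edist_supporting_hyperplane C p0 v0 (e : R) :
  closed C -> convex_set C -> C p0 -> 0 < e ->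
  (forall v, outer_normal C p0 v -> enorm v = 1 -> v = v0) ->
  exists2 d : R, 0 < d & forall p c a, C p -> enorm (p - p0) < d ->
    enorm (c - p0) < d -> a != 0 -> outer_normal C p a -> dotv (c - p) a = 0 ->
    edist c C <= e * enorm (c - p).
Proof.
move=> clC cvC Cp0 e0 uniq.
have e20 : 0 < e / 2 by rewrite divr_gt0.
have /nbhs_enormP[d d0 near_v0] := unit_normals_cvg e20 uniq.
exists d => // p c a Cp pd cd a0 Na ca.
have [_ <-] := proj_spec c clC (ex_intro _ p0 Cp0).
have qd := le_lt_trans (proj_fejer c clC cvC Cp0) cd.
have Nq := proj_normal c clC cvC.
set q := proj C c in qd Nq *.
have [->|cq] := eqVneq (c - q) 0.
  by rewrite enorm0 mulr_ge0 ?enorm_ge0 ?ltW.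
pose v := (enorm (c - q))^-1 *: (c - q); pose w := (enorm a)^-1 *: a.
have v1 : enorm v = 1 by exact: enorm_normalized.
have w1 : enorm w = 1 by exact: enorm_normalized.
have Nv : outer_normal C q v.
  by apply: outer_normalZ Nq; rewrite invr_ge0 enorm_ge0.
have Nw : outer_normal C p w.
  by apply: outer_normalZ Na; rewrite invr_ge0 enorm_ge0.
have vw : enorm (v - w) <= e.
  have := ler_enorm_dist v0 v w; rewrite (enormB v0 w).
  by have := near_v0 q qd v Nv v1; have := near_v0 p pd w Nw w1; lra.
(* Since [enorm (c - q) = dotv (c - q) v], split at [p] and subtract [dotv (c - p) w = 0]; the last
   term is nonpositive because [v] is normal at [q]. *)
have -> : enorm (c - q) = dotv (c - p) (v - w) + dotv (p - q) v.
  rewrite (dotvDr v) dotvNr (dotvZr (enorm a)^-1) ca mulr0 oppr0 addr0.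
  rewrite -dotvDl addrA subrK /v dotvZr -enorm_sqr expr2 mulKf//.
  by rewrite enorm_eq0.
apply: le_trans (_ : dotv (c - p) (v - w) <= _).
  by rewrite gerDl Nv.
apply: le_trans (dotv_le_enorm _ _) _.
by rewrite mulrC ler_wpM2r ?enorm_ge0.
Qed.

(** The point is a convex combination of [q] and the ball point [s + (r / d) *: (z - q)], whose
    offset cancels the error of replacing [z] by [q]. *)
Lemma convex_ball_shrink C s q z (r d : R) : convex_set C -> 0 < r -> 0 < d ->
  (forall y, enorm (y - s) <= r -> C y) -> C q -> enorm (z - q) <= d ->
  C ((d / (r + d)) *: s + (1 - d / (r + d)) *: z).
Proof.
move=> cvC r0 d0 ball Cq zq.
have Cb : C (s + (r / d) *: (z - q)).
  apply: ball; rewrite addrC addKr enormZ gtr0_norm ?divr_gt0//.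
  by rewrite mulrAC ler_pdivrMr// ler_pM2l.
have t01 : 0 <= d / (r + d) <= 1.
  by rewrite divr_ge0 ?ler_pdivrMr ?mul1r ?lerDr//; lra.
have := convex_setP cvC Cb Cq t01; congr C.
by apply/rowP => i; rewrite !mxE; field; lra.
Qed.

(** Linear regularity: the shrunken point depends only on [r], [d], [s] and [z], so the same one
    lies in [X] and in [Y]. *)
Lemma edist_inter_le (X Y : set 'rV[R]_n) s z (r d : R) :
  closed X -> convex_set X -> closed Y -> convex_set Y -> 0 < r ->
  (forall y, enorm (y - s) <= r -> (X `&` Y) y) ->
  edist z X <= d -> edist z Y <= d ->
  edist z (X `&` Y) <= enorm (z - s) / r * d.
Proof.
move=> clX cvX clY cvY r0 ball zX zY.
have [Xs Ys] : (X `&` Y) s by apply: ball; rewrite subrr enorm0 ltW.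
have [Xq qX] := proj_spec z clX (ex_intro _ s Xs).
have [Yq qY] := proj_spec z clY (ex_intro _ s Ys).
rewrite -{}qX in zX; rewrite -{}qY in zY.
have [d0|d0] := ltP 0 d.
  set t := d / (r + d).
  have St : (X `&` Y) (t *: s + (1 - t) *: z).
    split; [apply: convex_ball_shrink zX|apply: convex_ball_shrink zY] => //;
      by move=> y /ball[].
  apply: le_trans (edist_le z St) _.
  have -> : z - (t *: s + (1 - t) *: z) = t *: (z - s).
    by apply/rowP => i; rewrite !mxE; ring.
  rewrite enormZ ger0_norm ?divr_ge0//; [|lra..].
  rewrite mulrC -mulrA ler_wpM2l ?enorm_ge0// mulrC ler_wpM2l ?(ltW d0)//.
  by rewrite lef_pV2 ?posrE; lra.
have zq C : enorm (z - proj C z) <= d -> proj C z = z /\ d = 0.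
  move=> h; have := enorm_ge0 (z - proj C z) => h0.
  have /eqP : enorm (z - proj C z) = 0 by lra.
  by rewrite enorm_eq0 subr_eq0 => /eqP <-; split => //; lra.
have [zX' d0'] := zq _ zX; have [zY' _] := zq _ zY.
have Sz : (X `&` Y) z by split; [rewrite -zX'|rewrite -zY'].
by rewrite d0' mulr0; apply: le_trans (edist_le z Sz) _; rewrite subrr enorm0.
Qed.

End Tangency.

(** * One step of the iteration *)

Section Step.
Set Implicit Arguments.
Unset Strict Implicit.
Context {R : realType} {n : nat} (X Y : set 'rV[R]_n)
  (clX : closed X) (cvX : convex_set X) (clY : closed Y) (cvY : convex_set Y)
  (T : 'rV[R]_n -> 'rV[R]_n) (admT : admissible X Y T).
Implicit Types (s u w z : 'rV[R]_n) (t : R).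

(** [Nop X T t z] lies on the segment from [T z] to its projection, along which the projection onto
    [X] is constant. *)
Lemma proj_Nop t z : X !=set0 -> 0 < t < 1 ->
  proj X (Nop X T t z) = proj X (T z).
Proof.
move=> X0 /andP[t0 t1]; apply: proj_unique => //; first exact: proj_in.
move=> y Xy; rewrite /Nop; set w := T z; set x := proj X w.
have -> : t *: w + (1 - t) *: x - x = t *: (w - x).
  by apply/rowP => i; rewrite !mxE; ring.
by rewrite dotvZl pmulr_rle0//; exact: proj_obtuse.
Qed.

(** As [T z] is in [Y], the angle at [proj Y u] is obtuse; substituting
    [w - p = (1 - t) *: (w - x) + (u - p)] leaves the claim after dropping a square. *)
Lemma Nop_centralized t z s : (X `&` Y) s -> 0 < t < 1 ->
  dotv (Nop X T t z - proj X (Nop X T t z))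
    (Nop X T t z - proj Y (Nop X T t z)) <= 0.
Proof.
move=> [Xs Ys] t01; set u := Nop X T t z.
rewrite {2}/u proj_Nop//; last by exists s.
have [t0 t1] := andP t01.
have Yw := admT.1 z.
have := proj_obtuse u clY cvY Yw.
rewrite -/u; set w := T z; set x := proj X w; set p := proj Y u.
have -> : u - x = t *: (w - x).
  by apply/rowP => i; rewrite /u /Nop !mxE; ring.
have -> : w - p = (1 - t) *: (w - x) + (u - p).
  by apply/rowP => i; rewrite /u /Nop !mxE; ring.
rewrite dotvZl pmulr_rle0// (dotvC (w - x)) (dotvDr ((1 - t) *: _)) dotvZr.
have := dotv_ge0 (u - p) => h1 h2.
rewrite -(@pmulr_rle0 _ (1 - t)); lra.
Qed.

Lemma enorm_Nop_le t z s : (X `&` Y) s -> 0 < t < 1 ->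
  enorm (Nop X T t z - s) <= enorm (z - s).
Proof.
move=> Ss /andP[t0 t1].
have wz := admT.2 z s Ss.
have xw := proj_fejer (T z) clX cvX Ss.1.
rewrite /Nop; set w := T z in wz xw *; set x := proj X w in xw *.
have -> : t *: w + (1 - t) *: x - s = t *: (w - s) + (1 - t) *: (x - s).
  by apply/rowP => i; rewrite !mxE; ring.
apply: le_trans (ler_enormD _ _) _; rewrite !enormZ !ger0_norm; [|lra..].
by nra.
Qed.

(** These are the optimality conditions for projecting [u] onto the intersection of the two
    supporting hyperplanes, with multipliers of known sign. *)
Lemma PCRM_NopP t z s : (X `&` Y) s -> 0 < t < 1 ->
  let u := Nop X T t z in let c := PCRM X Y u in
  [/\ exists l m : R, [/\ l <= 0, m <= 0 &
        c = u + l *: (u - proj X u) + m *: (u - proj Y u)],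
      dotv (c - proj X u) (u - proj X u) = 0 &
      dotv (c - proj Y u) (u - proj Y u) = 0].
Proof.
move=> Ss t01 u c.
have supp (C : set 'rV[R]_n) : closed C -> convex_set C -> C s ->
    dotv (s - u) (u - proj C u) <= - dotv (u - proj C u) (u - proj C u).
  move=> clC cvC Cs; have := proj_obtuse u clC cvC Cs.
  have -> : s - proj C u = (s - u) + (u - proj C u) by rewrite addrA subrK.
  by rewrite dotvDr (dotvC _ (s - u)); lra.
have := circ_reflP (Nop_centralized z Ss t01) (supp X clX cvX Ss.1)
  (supp Y clY cvY Ss.2).
rewrite -!reflE -/(PCRM X Y u) -/c => -[lm eX eY]; split => //.
  have -> : c - proj X u = (c - u) + (u - proj X u) by rewrite addrA subrK.
  by rewrite dotvDl eX addNr.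
have -> : c - proj Y u = (c - u) + (u - proj Y u) by rewrite addrA subrK.
by rewrite dotvDl eY addNr.
Qed.

(** [u - c] is a nonnegative combination of two outer normals whose supporting hyperplanes contain
    [c], so it pairs nonpositively with [s - c]. *)
Lemma PCRM_Nop_fejer t z s : (X `&` Y) s -> 0 < t < 1 ->
  enorm (PCRM X Y (Nop X T t z) - s) <= enorm (z - s).
Proof.
move=> Ss t01; have [[l [m [l0 m0 cE]]] cX cY] := PCRM_NopP z Ss t01.
set u := Nop X T t z in cE cX cY *; set c := PCRM X Y u in cE cX cY *.
apply: le_trans (enorm_Nop_le z Ss t01); apply: enorm_sub_le; rewrite -/u.
have -> : u - c = (- l) *: (u - proj X u) + (- m) *: (u - proj Y u).
  by rewrite cE; apply/rowP => i; rewrite !mxE; ring.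
have side (C : set 'rV[R]_n) : closed C -> convex_set C -> C s ->
    dotv (c - proj C u) (u - proj C u) = 0 ->
    dotv (u - proj C u) (s - c) <= 0.
  move=> clC cvC Cs cC; rewrite dotvC.
  have -> : s - c = (s - proj C u) - (c - proj C u).
    by rewrite opprB addrA subrK.
  by rewrite dotvDl dotvNl cC subr0; exact: proj_normal.
have sX := side X clX cvX Ss.1 cX; have sY := side Y clY cvY Ss.2 cY.
rewrite dotvDl !dotvZl -[leRHS]addr0.
by apply: lerD; apply: mulr_ge0_le0; rewrite ?oppr_ge0.
Qed.

(** As [0 < t], membership of [u] in [X] forces [u = T z], which is in [Y]; both reflections fix
    [u], so the circumcenter is [u]. *)
Lemma PCRM_Nop_in_X t z s : (X `&` Y) s -> 0 < t < 1 ->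
  let u := Nop X T t z in u = proj X u -> (X `&` Y) (PCRM X Y u).
Proof.
move=> Ss t01 u ux; have [t0 _] := andP t01.
have X0 : X !=set0 by exists s; case: Ss.
have uw : u = T z.
  move: (ux); rewrite {2}/u proj_Nop// => ux'.
  have : t *: (T z - proj X (T z)) = 0.
    rewrite -[RHS](subrr u) [in X in _ = _ - X]ux' /u /Nop.
    by apply/rowP => i; rewrite !mxE; ring.
  by move/eqP; rewrite scaler_eq0 gt_eqF//= subr_eq0 => /eqP ->.
have Xu : X u by rewrite ux; exact: proj_in.
have Yu : Y u by rewrite uw; exact: admT.1.
have [[l [m [_ _ ->]]] _ _] := PCRM_NopP z Ss t01.
by rewrite -/u -ux (proj_id clY cvY Yu) subrr !scaler0 !addr0.
Qed.

(** The circumcenter is on the line through [u] and [proj X u], and on the hyperplane orthogonal to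
    it at [proj X u]. *)
Lemma PCRM_Nop_in_Y t z s : (X `&` Y) s -> 0 < t < 1 ->
  let u := Nop X T t z in u = proj Y u -> PCRM X Y u = proj X u.
Proof.
move=> Ss t01 u uy; have [[l [m [_ _ cE]]] cX _] := PCRM_NopP z Ss t01.
rewrite -/u -uy subrr scaler0 addr0 in cE cX *.
apply/eqP; rewrite -subr_eq0 -dotv_eq0.
have e : PCRM X Y u - proj X u = (1 + l) *: (u - proj X u).
  by rewrite cE; apply/rowP => i; rewrite !mxE; ring.
by rewrite {2}e dotvZr cX mulr0.
Qed.

End Step.

(** * Fejer monotonicity of the iterates and its consequence for the limit *)

Section Superlinear.
Set Implicit Arguments.
Unset Strict Implicit.
Context {R : realType} {n : nat} (X Y : set 'rV[R]_n)
  (clX : closed X) (cvX : convex_set X) (clY : closed Y) (cvY : convex_set Y)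
  (T : 'rV[R]_n -> 'rV[R]_n) (admT : admissible X Y T)
  (alpha : nat -> R) (alpha01 : forall k, 0 < alpha k < 1)
  (z0 zbar : 'rV[R]_n)
  (z_cvg : ecCRM X Y T alpha z0 k @[k --> \oo] --> zbar)
  (zbarS : (X `&` Y) zbar).

Let z := ecCRM X Y T alpha z0.
Let S := X `&` Y.

Lemma ecCRM_fejer s k m : S s -> (k <= m)%N ->
  enorm (z m - s) <= enorm (z k - s).
Proof.
move=> Ss /subnK <-; elim: (m - k)%N => [//|i IH].
exact: le_trans (PCRM_Nop_fejer clX cvX clY cvY admT _ Ss (alpha01 _)) IH.
Qed.

Lemma ecCRM_near (e : R) : 0 < e -> \forall k \near \oo, enorm (z k - zbar) < e.
Proof. by move=> /(enorm_nbhs zbar)/z_cvg. Qed.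

(** Later iterates stay within [edist (z k) S] of the projection of [z k] onto [S], hence so does
    their limit; conclude by the triangle inequality. *)
Lemma enorm_ecCRM_limit_le k : enorm (z k - zbar) <= 2 * edist (z k) S.
Proof.
have clS : closed S by exact: closedI.
have [Ss ds] := proj_spec (z k) clS (ex_intro _ _ zbarS).
set s := proj S (z k) in Ss ds.
have zs : enorm (s - zbar) <= edist (z k) S.
  apply/ler_addgt0Pr => e e0; near \oo => m.
  have km : (k <= m)%N by near: m; exact: nbhs_infty_ge.
  have := ecCRM_fejer Ss km; rewrite ds.
  have : enorm (z m - zbar) < e by near: m; exact: ecCRM_near.
  have := ler_enorm_dist (z m) s zbar; rewrite (enormB s (z m)); lra.
have := ler_enorm_dist s (z k) zbar; rewrite ds; lra.
Unshelve. all: by end_near. Qed.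

End Superlinear.

(** * Distance to each set after one step *)

Section StepEstimate.
Set Implicit Arguments.
Unset Strict Implicit.

(* When [u] lies in [Y] the circumcenter need not lie on a supporting
   hyperplane of [Y]; it is then [proj X u], at distance at most [t * enorm (z - s)] from [u]. *)
Lemma edist_PCRM_Nop_le {R : realType} {n : nat} (X Y : set 'rV[R]_n)
    (T : 'rV[R]_n -> 'rV[R]_n) (p0 vX vY : 'rV[R]_n) (e : R) :
  closed X -> convex_set X -> closed Y -> convex_set Y -> admissible X Y T ->
  (X `&` Y) p0 -> 0 < e ->
  (forall v, outer_normal X p0 v -> enorm v = 1 -> v = vX) ->
  (forall v, outer_normal Y p0 v -> enorm v = 1 -> v = vY) ->
  exists2 d : R, 0 < d & forall (t : R) (z s : 'rV[R]_n), 0 < t < 1 -> t < d ->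
    enorm (z - p0) < d -> (X `&` Y) s ->
    let c := PCRM X Y (Nop X T t z) in
    (X `&` Y) c \/ (edist c X <= e * enorm (z - s) /\
                    edist c Y <= e * enorm (z - s)).
Proof.
move=> clX cvX clY cvY admT Sp0 e0 uX uY.
have [Xp0 Yp0] := Sp0.
have e20 : 0 < e / 2 by rewrite divr_gt0.
have [dX dX0 hX] := edist_supporting_hyperplane clX cvX Xp0 e20 uX.
have [dY dY0 hY] := edist_supporting_hyperplane clY cvY Yp0 e20 uY.
(* The bound [t < e] serves the case of [u] in [Y]; [dX] and [dY] keep [c] and the projections of
   [u] near [p0]. *)
exists (Num.min e (Num.min dX dY)); first by rewrite !lt_min e0 dX0 dY0.
move=> t z s t01; rewrite !lt_min => /andP[te _] /and3P[_ zX zY] Ss c.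
have uF s' : (X `&` Y) s' -> enorm (Nop X T t z - s') <= enorm (z - s').
  by move=> Ss'; exact: (enorm_Nop_le clX cvX admT z Ss' t01).
have cF s' : (X `&` Y) s' -> enorm (c - s') <= enorm (z - s').
  by move=> Ss'; exact: (PCRM_Nop_fejer clX cvX clY cvY admT z Ss' t01).
have [_ cX cY] := PCRM_NopP clX cvX clY cvY admT z Ss t01.
have inX := PCRM_Nop_in_X clX cvX clY cvY admT Ss t01 (z := z).
have inY := PCRM_Nop_in_Y clX cvX clY cvY admT Ss t01 (z := z).
rewrite -/c in cX cY inX inY.
have uw : Nop X T t z - proj X (Nop X T t z) = t *: (T z - proj X (T z)).
  rewrite proj_Nop//; last by exists p0.
  by apply/rowP => i; rewrite /Nop !mxE; ring.
set u := Nop X T t z in uF cX cY inX inY uw.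
have pF (C : set 'rV[R]_n) s' : closed C -> convex_set C -> (X `&` Y) s' -> C s' ->
    enorm (proj C u - s') <= enorm (z - s').
  by move=> clC cvC Ss' Cs'; apply: le_trans (proj_fejer _ clC cvC Cs') (uF _ Ss').
(* Both [c] and [proj C u] are within [enorm (z - s)] of [s], so within twice that of each other;
   hence [e / 2]. *)
have half (C : set 'rV[R]_n) : closed C -> convex_set C -> C s ->
    e / 2 * enorm (c - proj C u) <= e * enorm (z - s).
  move=> clC cvC Cs; rewrite -mulrA ler_wpM2l ?(ltW e0)//.
  have := ler_enorm_dist s c (proj C u); rewrite (enormB s (proj C u)).
  by have := cF _ Ss; have := pF _ _ clC cvC Ss Cs; lra.
have [Xs Ys] := Ss.
have [ux|ux] := eqVneq u (proj X u); [by left; exact: inX|right; split].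
  apply: le_trans (half X clX cvX Xs); apply: (hX _ _ (u - proj X u)).
  - by apply: proj_in => //; exists s.
  - exact: le_lt_trans (pF _ _ clX cvX Sp0 Xp0) zX.
  - exact: le_lt_trans (cF _ Sp0) zX.
  - by rewrite subr_eq0; exact: ux.
  - exact: proj_normal.
  - exact: cX.
have [uy|uy] := eqVneq u (proj Y u).
  have Yu : Y u by rewrite uy; apply: proj_in => //; exists s.
  apply: le_trans (edist_le _ Yu) _; have -> : c = proj X u by exact: inY.
  rewrite enormB uw.
  have [t0 _] := andP t01; rewrite enormZ gtr0_norm//.
  apply: ler_pM => //; [exact: ltW|exact: enorm_ge0|exact: ltW|].
  apply: le_trans (admT.2 z s Ss).
  have [_ ->] := proj_spec (T z) clX (ex_intro _ s Xs).
  exact: edist_le.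
apply: le_trans (half Y clY cvY Ys); apply: (hY _ _ (u - proj Y u)).
- by apply: proj_in => //; exists s.
- exact: le_lt_trans (pF _ _ clY cvY Sp0 Yp0) zY.
- exact: le_lt_trans (cF _ Sp0) zY.
- by rewrite subr_eq0; exact: uy.
- exact: proj_normal.
- exact: cY.
Qed.

End StepEstimate.

(** * Superlinear convergence of the distances and of the iterates *)

Theorem theorem4p10 (R : realType) (n : nat) (X Y : set 'rV[R]_n)
    (clX : closed X) (cvX : convex_set X)
    (clY : closed Y) (cvY : convex_set Y)
    (S_neq0 : X `&` Y !=set0)
    (T : 'rV[R]_n -> 'rV[R]_n) (admT : admissible X Y T)
    (alpha : nat -> R) (alpha01 : forall k, 0 < alpha k < 1)
    (alpha_cvg0 : alpha k @[k --> \oo] --> (0 : R))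
    (z0 zbar : 'rV[R]_n)
    (z_cvg : ecCRM X Y T alpha z0 k @[k --> \oo] --> zbar)
    (zbarS : (X `&` Y) zbar)
    (intS : interior (X `&` Y) !=set0)
    (zbar_bd : (boundary X `&` boundary Y) zbar)
    (bd_C1 : exists W : set 'rV[R]_n,
       [/\ open_nbhs zbar W,
           C1_submanifold n.-1 (boundary X `&` W) &
           C1_submanifold n.-1 (boundary Y `&` W)]) :
  superlinear_to0 (fun k => edist (ecCRM X Y T alpha z0 k) (X `&` Y)) /\
  superlinear_to (ecCRM X Y T alpha z0) zbar.
Proof.
set z := ecCRM X Y T alpha z0; set S := X `&` Y.
have dist_ge0 k : 0 <= edist (z k) S by exact: edist_ge0.
have dist_le k : edist (z k) S <= enorm (z k - zbar) by exact: edist_le.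
have le_dist k : enorm (z k - zbar) <= 2 * edist (z k) S.
  exact: (enorm_ecCRM_limit_le clX cvX clY cvY admT alpha01 z_cvg zbarS).
have cvg0 : enorm (z k - zbar) @[k --> \oo] --> (0 : R).
  apply/cvgr0Pnorm_lt => e e0; near=> k.
  by rewrite ger0_norm ?enorm_ge0//; near: k; exact: (ecCRM_near z_cvg).
(* The distance to [S] and to [zbar] agree up to a factor 2, absorbed by [e / 2], so one estimate
   gives both rates. *)
suff slow (e : R) : 0 < e ->
    \forall k \near \oo, edist (z k.+1) S <= e * edist (z k) S.
  split; split => //.
  - apply: squeeze_cvgr (cvg_cst 0) cvg0.
    by apply: nearW => k; rewrite dist_ge0 dist_le.
  - by move=> k; exact: enorm_ge0.
  - move=> e e0; have e20 : 0 < e / 2 by rewrite divr_gt0.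
    have := slow _ e20; apply: filterS => k /= h.
    have := le_dist k.+1; have := ler_wpM2l (ltW e0) (dist_le k); lra.
move=> e0.
have [s0 Ss0] := intS; have [r r0 ball] := nbhs_enormP Ss0.
(* Halving [r] turns the open ball inside [S] into a closed one. *)
have ball2 y : enorm (y - s0) <= r / 2 -> S y by move=> h; apply: ball; lra.
have r20 : 0 < r / 2 by rewrite divr_gt0.
have Ss0' : S s0 by apply: ball2; rewrite subrr enorm0 ltW.
have [W [zbarW XC1 YC1]] := bd_C1; have [bX bY] := zbar_bd.
have [vX uX] : exists vX,
    forall v, outer_normal X zbar v -> enorm v = 1 -> v = vX.
  (* Without a unit normal the claim is vacuous and 0 is a dummy value. *)
  have [[w [Nw w1]]|no] :=
      pselect (exists w, outer_normal X zbar w /\ enorm w = 1); last first.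
    by exists 0 => v Nv v1; exfalso; apply: no; exists v.
  exists w => v Nv v1; apply: (C1_boundary_normal_unique clX _ zbarW bX XC1) => //.
  by apply: filterS Ss0 => y [].
have [vY uY] : exists vY,
    forall v, outer_normal Y zbar v -> enorm v = 1 -> v = vY.
  have [[w [Nw w1]]|no] :=
      pselect (exists w, outer_normal Y zbar w /\ enorm w = 1); last first.
    by exists 0 => v Nv v1; exfalso; apply: no; exists v.
  exists w => v Nv v1; apply: (C1_boundary_normal_unique clY _ zbarW bY YC1) => //.
  by apply: filterS Ss0 => y [].
(* By Fejer monotonicity [M] bounds every [enorm (z k.+1 - s0)], and the added 1 makes it positive.
   The tolerance [e * (r / 2) / M] then offsets the regularity factor
   [enorm (z k.+1 - s0) / (r / 2)]. *)
set M := enorm (z 0%N - s0) + 1.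
have M0 : 0 < M by have := enorm_ge0 (z 0%N - s0); rewrite /M; lra.
have e'0 : 0 < e * (r / 2) / M by rewrite divr_gt0 ?mulr_gt0.
have [d d0 step] := edist_PCRM_Nop_le clX cvX clY cvY admT zbarS e'0 uX uY.
near=> k.
have [Sp dp] : S (proj S (z k)) /\ enorm (z k - proj S (z k)) = edist (z k) S.
  by apply: proj_spec; [exact: closedI|exists zbar].
have ad : alpha k < d by near: k; exact: (cvgr_lt _ alpha_cvg0).
have zd : enorm (z k - zbar) < d by near: k; exact: (ecCRM_near z_cvg).
have := step (alpha k) (z k) _ (alpha01 k) ad zd Sp; rewrite dp.
rewrite -/(z k.+1) => -[Sc|[cX cY]].
  apply: le_trans (edist_le (z k.+1) Sc) _.
  by rewrite subrr enorm0 mulr_ge0// ltW.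
apply: le_trans (edist_inter_le clX cvX clY cvY r20 ball2 cX cY) _.
have cM : enorm (z k.+1 - s0) <= M.
  apply: le_trans (ecCRM_fejer clX cvX clY cvY admT alpha01 z0 Ss0' (leq0n _)) _.
  by rewrite /M lerDl.
have -> D : enorm (z k.+1 - s0) / (r / 2) * (e * (r / 2) / M * D) =
    enorm (z k.+1 - s0) / M * (e * D) by field; rewrite !gt_eqF.
by rewrite ler_piMl ?mulr_ge0 ?(ltW e0)// ler_pdivrMr// mul1r.
Unshelve. all: by end_near. Qed.
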